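(* Let $(\mathbb{S},\Sigma)$ be a measurable space, let the sequence $\{\mu^{(n)}\}_{n=1,2,\ldots}\subset\mathcal{M}(\mathbb{S})$ converge in total variation to a measure $\mu$ on $\mathbb{S}$, let $f\in L^1(\mathbb{S};\mu)$, and let $f^{(n)}\in L^1(\mathbb{S};\mu^{(n)})$ for each $n=1,2,\ldots$. Then the equality $$\lim_{n\to\infty}\ \sup_{S\in\Sigma}\left|\int_S f^{(n)}(s)\,\mu^{(n)}(ds)-\int_S f(s)\,\mu(ds)\right|=0$$ holds if and only if the following two statements hold: (i) the sequence $\{f^{(n)}\}_{n=1,2,\ldots}$ converges in measure $\mu$ to $f$, and, therefore (as a consequence), there is a subsequence $\{f^{(n_k)}\}_{k=1,2,\ldots}$ of $\{f^{(n)}\}_{n=1,2,\ldots}$ that converges $\mu$-a.e. to $f$; (ii) the following equality holds: $$\lim_{K\to+\infty}\ \sup_{n=1,2,\ldots}\int_{\{s\in\mathbb{S}:\,|f^{(n)}(s)|\ge K\}}|f^{(n)}(s)|\,\mu^{(n)}(ds)=0.$$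
   Context: $\mathcal{M}(\mathbb{S})$ is the family of finite (nonnegative) measures on $(\mathbb{S},\Sigma)$. Functions $f:\mathbb{S}\to\overline{\mathbb{R}}:=\mathbb{R}\cup\{\pm\infty\}$ are called measurable if $\{s\in\mathbb{S}: f(s)<\alpha\}\in\Sigma$ for each $\alpha\in\mathbb{R}$. For a finite measure $\nu$, $L^1(\mathbb{S};\nu)$ is the set of all measurable functions $g:\mathbb{S}\to\overline{\mathbb{R}}$ with $\int_{\mathbb{S}}|g(s)|\,\nu(ds)<+\infty$ (functions, not equivalence classes). For $\mu\in\mathcal{M}(\mathbb{S})$ and a measure $\nu$ on $\mathbb{S}$, $\mathrm{dist}(\mu,\nu):=\sup\{|\int_{\mathbb{S}} g\,d\mu-\int_{\mathbb{S}} g\,d\nu| : g:\mathbb{S}\to[-1,1]\text{ measurable}\}$; finite measures $\mu^{(n)}$ converge in total variation to a measure $\mu$ if $\lim_{n\to\infty}\mathrm{dist}(\mu^{(n)},\mu)=0$ (then $\mu$ is automatically finite). Convergence in measure $\mu$ of $f^{(n)}$ to $f$ means $\mu(\{s\in\mathbb{S}:|f^{(n)}(s)-f(s)|\ge\varepsilon\})\to0$ as $n\to\infty$ for each $\varepsilon>0$ (note that $f\in L^1(\mathbb{S};\mu)$ is finite $\mu$-a.e.). *)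

(* Defs.v *)
From mathcomp Require Import all_boot all_order all_algebra.
From mathcomp Require Import all_classical all_reals all_analysis.

Set Implicit Arguments.
Unset Strict Implicit.
Unset Printing Implicit Defensive.

Import Order.TTheory GRing.Theory Num.Theory.
Import numFieldNormedType.Exports.

Local Open Scope classical_set_scope.
Local Open Scope ring_scope.
Local Open Scope ereal_scope.

(* Taking g = 1 shows that the value is +oo when mu is finite and nu is not:
   the supremum is taken in \bar R. *)
Definition tv_dist d (T : measurableType d) (R : realType)
    (mu nu : set T -> \bar R) : \bar R :=
  ereal_sup [set `|\int[mu]_x (g x)%:E - \int[nu]_x (g x)%:E| | g in
    [set g : T -> R | measurable_fun setT g /\
                      forall x, (-1 <= g x <= 1)%R]].

Definition cvg_tv d (T : measurableType d) (R : realType)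
    (mu_ : nat -> set T -> \bar R) (mu : set T -> \bar R) : Prop :=
  tv_dist (mu_ n) mu @[n --> \oo] --> 0.

(* By convention `|+oo - +oo| = `|-oo - -oo| = +oo in \bar R, so the points
   where f_ n x and f x are the same infinity are counted as far apart. This is
   immaterial as soon as f is finite mu-a.e. *)
Definition cvg_in_measure d (T : measurableType d) (R : realType)
    (mu : set T -> \bar R) (f_ : nat -> T -> \bar R) (f : T -> \bar R) : Prop :=
  forall eps : R, (0 < eps)%R ->
    mu [set x | eps%:E <= `|f_ n x - f x|] @[n --> \oo] --> 0.

Definition cvg_ae d (T : measurableType d) (R : realType)
    (mu : {measure set T -> \bar R})
    (f_ : nat -> T -> \bar R) (f : T -> \bar R) : Prop :=
  {ae mu, forall x, f_ n x @[n --> \oo] --> f x}.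

(* Main.v *)
Require Import Defs.
From mathcomp Require Import all_boot all_order all_algebra.
From mathcomp Require Import all_classical all_reals all_analysis.
From mathcomp Require Import measurable_realfun zify ring lra.

(** The proof is quantitative: two fixed finite measures nu, mu at total
variation distance at most t, and two functions g in L1(nu), f in L1(mu), are
compared by explicit inequalities, and the theorem follows by applying them to
nu = mu_ n, g = f_ n and letting n go to infinity. Everything rests on the
remark that a measurable function bounded by K changes its integral over any
set by at most K * t when nu is replaced by mu ([tv_integral_le]); unbounded
functions are brought down to this case by clamping them to the interval
from - K to K ([trunc]), at the cost of the tail integral of the absolute value
over the set where it is at least K ([integral_trunc_le]).

If convergence in measure and uniform integrability hold, pass from g d(nu) to
f d(mu) through the truncations: the two truncation errors are tails, the
change of measure costs K * t, and the truncations of g and f, both bounded by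
K, differ by less than del outside a set of small mu-measure
([dist_integral_le]). None of these bounds depends on the set of integration.

Conversely, suppose that the integrals of g d(nu) and f d(mu) differ by at most
e on every measurable set. Testing on the set where f is at most K in absolute
value and g exceeds f by eps makes eps times the measure of this set smaller
than a multiple of e and t ([measure_excess_le]); with the symmetric set this
gives convergence in measure ([measure_dist_le]). Testing on the parts of a set
where g is nonnegative and negative bounds the integral of the absolute value
of g by that of f, up to 2 * e ([integral_abs_le]). On the set where g is at
least K in absolute value, whose measure is small by Markov's inequality, the
integral of the absolute value of f is small by absolute continuity; this is
uniform integrability for all large n ([tail_le]), and the finitely many
remaining n are covered by the integrability of each f_ n.

The almost everywhere convergent subsequence comes from the Borel-Cantelli
lemma ([cvg_in_measure_subseq]). *)

Set Implicit Arguments.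
Unset Strict Implicit.
Unset Printing Implicit Defensive.

Import Order.TTheory GRing.Theory Num.Theory.
Import numFieldNormedType.Exports.

Local Open Scope classical_set_scope.
Local Open Scope ring_scope.
Local Open Scope ereal_scope.

(** * Convergence to zero in the extended reals *)

Lemma ge0_cvge0P (R : realType) (I : Type) (F : set_system I) (FF : Filter F)
    (u : I -> \bar R) : (forall i, 0 <= u i) ->
  u @ F --> 0 <->
  forall e : R, (0 < e)%R -> \forall i \near F, u i <= e%:E.
Proof.
move=> u0; split=> [/fine_cvgP[ufin /cvgr0Pnorm_le ule] e e0|ule].
  near=> i.
  have ui : u i \is a fin_num by near: i.
  rewrite -(fineK ui) lee_fin (le_trans (ler_norm _))//.
  by near: i; exact: ule.
have ufin : \forall i \near F, u i \is a fin_num.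
  near=> i; rewrite ge0_fin_numE//; apply: (@le_lt_trans _ _ 1%:E).
    by near: i; exact: ule.
  exact: ltry.
apply/fine_cvgP; split => //; apply/cvgr0Pnorm_le => e e0.
near=> i.
have ui : u i \is a fin_num by near: i.
rewrite ger0_norm/=; last exact: fine_ge0.
by rewrite -lee_fin fineK//; near: i; exact: ule.
Unshelve. all: by end_near. Qed.

(** * Truncation *)

Section truncation.
Variable R : realType.
Implicit Types (K : R) (x y : \bar R).

(** Real valued, so that truncations can be fed to the test functions of
[tv_dist]; the infinite values are sent to K and - K. *)
Definition trunc K x : R := fine (mine K%:E (maxe (- K)%:E x)).

Lemma truncr K (r : R) : trunc K r%:E = (Num.min K (Num.max (- K) r))%R.
Proof. by rewrite /trunc -EFin_max -EFin_min. Qed.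

Variant trunc_spec K (r : R) : R -> Prop :=
  | TruncLow of (r <= - K)%R : trunc_spec K r (- K)%R
  | TruncMid of (- K <= r)%R & (r <= K)%R : trunc_spec K r r
  | TruncHigh of (K <= r)%R : trunc_spec K r K.

Lemma truncP K (r : R) : (0 <= K)%R -> trunc_spec K r (trunc K r%:E).
Proof.
move=> K0; rewrite truncr.
have [rK|Kr] := leP r (- K)%R.
  by rewrite min_r; [exact: TruncLow|lra].
have [rK|Kr'] := leP r K.
  by apply: TruncMid => //; exact: ltW.
by apply: TruncHigh; exact: ltW.
Qed.

Lemma truncy K : trunc K +oo = K.
Proof. by rewrite /trunc maxey miney. Qed.

Lemma truncNy K : (0 <= K)%R -> trunc K -oo = (- K)%R.
Proof.
by move=> K0; rewrite /trunc maxeNy -EFin_min/=; apply/min_idPr; lra.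
Qed.

Lemma trunc_le K x : (0 <= K)%R -> (`|trunc K x| <= K)%R.
Proof.
move=> K0; case: x => [r| |]; rewrite ?truncy ?truncNy// ler_norml.
- by case: truncP => //; lra.
- by lra.
- by lra.
Qed.

Lemma trunc_id K x : `|x| <= K%:E -> (trunc K x)%:E = x.
Proof.
case: x => [r| |]//; rewrite /= lee_fin ler_norml => rK; congr EFin.
by case: truncP; lra.
Qed.

(** Clamping is 1-Lipschitz on the reals; as soon as x or y is infinite, the
right-hand side is +oo. *)
Lemma dist_trunc_le K x y : (0 <= K)%R ->
  `|(trunc K x)%:E - (trunc K y)%:E| <= `|x - y|.
Proof.
move=> K0; case: x => [r| |]; case: y => [s| |];
  rewrite ?truncy ?truncNy//= ?leey// lee_fin ?subrr ?normr0//.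
case: (truncP r K0) => ?; case: (truncP s K0) => ?;
  case: (ger0P (r - s)) => ?; rewrite ?ler_norml; lra.
Qed.

Lemma trunc_dist_le K x : (0 <= K)%R -> `|x - (trunc K x)%:E| <= `|x|.
Proof.
move=> K0; case: x => [r| |]; rewrite ?leey//= lee_fin.
by case: (truncP r K0) => ?; case: (ger0P r) => ?; rewrite ?ler_norml; lra.
Qed.

Lemma measurable_trunc d (T : measurableType d) K (D : set T)
    (f : T -> \bar R) :
  measurable_fun D f -> measurable_fun D (trunc K \o f).
Proof.
move=> mf; apply: (measurableT_comp (fine_measurable measurableT)).
by apply: measurable_mine => //; exact: measurable_maxe.
Qed.

End truncation.

(** * Tail integrals *)

Section tails.
Context d (T : measurableType d) (R : realType).
Variable mu : {measure set T -> \bar R}.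
Implicit Types (f g : T -> \bar R) (A : set T) (K : R).

Lemma integral_realE A f : measurable A -> mu.-integrable setT f ->
  exists r : R, \int[mu]_(x in A) f x = r%:E.
Proof.
move=> mA fi; have fA : mu.-integrable A f by exact: integrableS fi.
by exists (fine (\int[mu]_(x in A) f x)); rewrite fineK// integrable_fin_num.
Qed.

Lemma measurable_abs_ge f K : measurable_fun setT f ->
  measurable [set x | K%:E <= `|f x|].
Proof.
move=> mf; rewrite -[X in measurable X]setTI.
by apply: emeasurable_fun_c_infty => //; exact: measurableT_comp.
Qed.

Definition tail f K := \int[mu]_(x in [set x | K%:E <= `|f x|]) `|f x|.

Lemma tail_ge0 f K : 0 <= tail f K.
Proof. by apply: integral_ge0. Qed.

Lemma tail_nonincreasing f : measurable_fun setT f ->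
  {homo tail f : K L / (K <= L)%R >-> L <= K}.
Proof.
move=> mf K L KL; apply: ge0_subset_integral => //.
- exact: measurable_abs_ge.
- exact: measurable_abs_ge.
- by apply: measurableT_comp => //; exact: measurable_funTS.
- by move=> x /=; apply: le_trans; rewrite lee_fin.
Qed.

(** Dominated convergence along the integers, the dominating function being
`|f|; monotonicity in K then gives the limit along the reals. *)
Lemma tail_cvg0 f : mu.-integrable setT f -> tail f K @[K --> +oo%R] --> 0.
Proof.
move=> fi; have mf := measurable_int mu fi.
have tail_cvgn : tail f n%:R @[n --> \oo] --> 0.
  pose h n : T -> \bar R := (abse \o f) \_ [set x | n%:R%:E <= `|f x|].
  have mh n : measurable_fun setT (h n).
    apply/(measurable_restrictT _ (measurable_abs_ge _ mf)).
    by apply: measurableT_comp => //; exact: measurable_funTS.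
  have h0 : {ae mu, forall x, setT x -> h n x @[n --> \oo] --> cst 0 x}.
    have := integrable_ae measurableT fi; apply: filterS => x /(_ I) fx _.
    apply: cvg_near_cst; near=> n; rewrite /h patchE ifF//; apply/negbTE/negP.
    rewrite inE /= leNgt => /negP; apply.
    rewrite -(fineK fx)/= lte_fin; near: n.
    exact: (nbhs_infty_gtr (`|fine (f x)|)%R).
  have hf : {ae mu, forall x n, setT x -> `|h n x| <= `|f x|}.
    apply/aeW => x n _; rewrite /h patchE; case: ifPn => _ //=.
      by rewrite abse_id.
    by rewrite normr0 abse_ge0.
  have [_ _] := dominated_convergence measurableT mh (measurable_cst _) h0
    (integrable_abse fi) hf.
  rewrite integral0; apply: cvg_trans; apply: near_eq_cvg.
  by near=> n; rewrite /tail [RHS]integral_mkcond.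
apply/ge0_cvge0P => [K|e e0]; first exact: tail_ge0.
have /ge0_cvge0P/(_ e e0)[|N _ /(_ N (leqnn N)) tailN] := tail_cvgn.
  by move=> n; exact: tail_ge0.
near=> K; apply: le_trans tailN; apply: (tail_nonincreasing mf).
near: K; exact: nbhs_pinfty_ge.
Unshelve. all: by end_near. Qed.

Lemma markov_abs_ge f K (c : R) : measurable_fun setT f -> (0 < K)%R ->
  \int[mu]_x `|f x| <= c%:E -> mu [set x | K%:E <= `|f x|] <= (c / K)%:E.
Proof.
move=> mf K0 fc; have := le_integral_abse mu measurableT mf K0.
rewrite setTI => /le_trans/(_ fc) h.
rewrite EFinM -(@lee_pmul2l _ K%:E)// ?fin_numE// -EFinM.
by rewrite -EFinM mulrCA mulfV ?gt_eqF// mulr1.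
Qed.

Lemma measure_abs_ge_tail f K : measurable_fun setT f -> (1 <= K)%R ->
  mu [set x | K%:E <= `|f x|] <= tail f K.
Proof.
move=> mf K1; have mA := measurable_abs_ge K mf.
rewrite -[leLHS]mul1e -(integral_cst mu mA); apply: ge0_le_integral => //.
- by apply: measurableT_comp => //; exact: measurable_funTS.
- by move=> x /=; apply: le_trans; rewrite lee_fin.
Qed.

(** f and its truncation agree where `|f x| < K, and elsewhere they differ by at
most `|f x|. *)
Lemma integral_trunc_le f K A (t : R) : measurable A ->
  mu.-integrable setT f -> (0 <= K)%R -> tail f K <= t%:E ->
  mu.-integrable setT (EFin \o (trunc K \o f)) ->
  `|\int[mu]_(x in A) f x - \int[mu]_(x in A) (trunc K (f x))%:E| <= t%:E.
Proof.
move=> mA fi K0 ft ti; have mf := measurable_int mu fi.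
have fiA : mu.-integrable A f by exact: integrableS fi.
have tiA : mu.-integrable A (EFin \o (trunc K \o f)) by exact: integrableS ti.
have mB := measurable_int mu (integrableB mA fiA tiA).
have mBT := measurable_int mu (integrableB measurableT fi ti).
rewrite -(integralB mA fiA tiA) (le_trans (le_abse_integral _ mA mB))//.
apply: le_trans ft; rewrite /tail [leRHS]integral_mkcond.
apply: (@le_trans _ _ (\int[mu]_x `|f x - (trunc K (f x))%:E|)).
  by apply: ge0_subset_integral => //; exact: measurableT_comp.
apply: ge0_le_integral => //.
- exact: measurableT_comp.
- apply/(measurable_restrictT _ (measurable_abs_ge _ mf)).
  by apply: measurableT_comp => //; exact: measurable_funTS.
move=> x _; rewrite patchE; case: ifPn => [_|]; first exact: trunc_dist_le.
rewrite notin_setE => fxK'.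
have fxK : `|f x| < K%:E by rewrite ltNge; apply/negP.
rewrite (trunc_id (ltW fxK)) subee ?abse0//.
by case: (f x) fxK.
Qed.

End tails.

(** * Measures close in total variation *)

Section total_variation.
Context d (T : measurableType d) (R : realType).
Implicit Types (mu nu : {measure set T -> \bar R}) (A : set T) (t K : R).

Lemma bounded_integrable mu (g : T -> R) K : mu setT < +oo ->
  measurable_fun setT g -> (forall x, `|g x| <= K)%R ->
  mu.-integrable setT (EFin \o g).
Proof.
move=> muT mg gK; apply: measurable_bounded_integrable => //.
exists K; split; first exact: num_real.
by move=> M KM x _; exact: le_trans (gK x) (ltW KM).
Qed.

(** The function K^-1 * g * \1_A is an admissible test function for the
distance. *)
Lemma tv_integral_le nu mu (g : T -> R) A K t :
  nu setT < +oo -> mu setT < +oo -> tv_dist nu mu <= t%:E ->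
  measurable A -> measurable_fun setT g -> (0 < K)%R ->
  (forall x, `|g x| <= K)%R ->
  `|\int[nu]_(x in A) (g x)%:E - \int[mu]_(x in A) (g x)%:E| <= (K * t)%:E.
Proof.
move=> nuT muT numu mA mg K0 gK.
pose h x : R := (K^-1 * (g x * \1_A x))%R.
have mh : measurable_fun setT h.
  by apply: measurable_funM => //; exact: measurable_funM.
have h1 x : (`|h x| <= 1)%R.
  rewrite /h normrM gtr0_norm ?invr_gt0// mulrC ler_pdivrMr// mul1r indicE.
  by case: (x \in A); rewrite ?mulr1 ?mulr0 ?normr0// ltW.
have intE (m : {measure set T -> \bar R}) : m setT < +oo ->
    \int[m]_(x in A) (g x)%:E = K%:E * \int[m]_x (h x)%:E.
  move=> mT; rewrite -integralZl//; last exact: (bounded_integrable mT mh h1).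
  rewrite integral_mkcond; apply: eq_integral => x _; rewrite patchE /h indicE.
  rewrite -EFinM mulrA mulfV ?gt_eqF// mul1r.
  by case: (x \in A); rewrite ?mulr1 ?mulr0.
rewrite !intE// -muleBr//; last first.
  apply: fin_num_adde_defr; apply: integrable_fin_num => //.
  exact: (bounded_integrable nuT mh h1).
rewrite abseM gee0_abs; last by rewrite lee_fin ltW.
rewrite EFinM lee_pmul2l//.
apply: le_trans numu; apply: le_ereal_sup_tmp.
exists `|\int[nu]_x (h x)%:E - \int[mu]_x (h x)%:E| => //.
by exists h => //; split => // x; rewrite -ler_norml.
Qed.

Lemma integral_one mu A : measurable A ->
  \int[mu]_(x in A) (cst 1%R x)%:E = mu A.
Proof. by move=> mA; have := integral_cst mu mA 1; rewrite mul1e. Qed.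

(** Otherwise the constant test function 1 would give an infinite distance. *)
Lemma tv_finite nu mu t : nu setT < +oo -> tv_dist nu mu <= t%:E ->
  mu setT < +oo.
Proof.
move=> nuT numu; rewrite ltey; apply/negP => /eqP muT; move: numu.
apply/negP; rewrite -ltNge (@lt_le_trans _ _ +oo) ?ltry//.
apply: le_ereal_sup_tmp; exists +oo => //.
exists (cst 1%R); first by split => // x /=; lra.
rewrite !integral_one// muT.
have /fineK <- : nu setT \is a fin_num by rewrite ge0_fin_numE.
by [].
Qed.

Lemma tv_measure_le nu mu A t : nu setT < +oo -> mu setT < +oo ->
  tv_dist nu mu <= t%:E -> measurable A -> mu A <= nu A + t%:E.
Proof.
move=> nuT muT numu mA.
have one_le (x : T) : (`|cst 1 x : R| <= 1)%R by rewrite normr1.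
have := tv_integral_le nuT muT numu mA (measurable_cst _) ltr01 one_le.
rewrite !integral_one// mul1r.
have finA (m : {measure set T -> \bar R}) : m setT < +oo ->
    exists r : R, m A = r%:E.
  move=> mT; exists (fine (m A)); rewrite fineK// ge0_fin_numE//.
  by apply: le_lt_trans mT; rewrite le_measure// inE.
have [a ->] := finA _ nuT; have [b ->] := finA _ muT.
rewrite -EFinB -EFinD !lee_fin ler_norml; lra.
Qed.

End total_variation.

(** * Comparison of two integrals on all measurable sets *)

Section comparison.
Context d (T : measurableType d) (R : realType).
Variables nu mu : {measure set T -> \bar R}.
Hypotheses (nuT : nu setT < +oo) (muT : mu setT < +oo).
Variable t : R.
Hypothesis numu : tv_dist nu mu <= t%:E.
Variables g f : T -> \bar R.
Hypotheses (gi : nu.-integrable setT g) (fi : mu.-integrable setT f).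

Let mg : measurable_fun setT g. Proof. exact: measurable_int gi. Qed.
Let mf : measurable_fun setT f. Proof. exact: measurable_int fi. Qed.

Let mB : forall del : R, measurable [set x | del%:E <= `|g x - f x|].
Proof.
by move=> del; apply: measurable_abs_ge; exact: emeasurable_funB.
Qed.

Let trunc_int (m : {measure set T -> \bar R}) (h : T -> \bar R) K :
  m setT < +oo -> measurable_fun setT h -> (0 <= K)%R ->
  m.-integrable setT (EFin \o (trunc K \o h)).
Proof.
move=> mT mh K0; apply: (@bounded_integrable _ _ _ _ _ K) => //.
  exact: measurable_trunc.
by move=> x; exact: trunc_le.
Qed.

(** The two truncations differ by at most 2 * K where g and f are del-far, and
by at most del elsewhere. *)
Lemma integral_trunc_dist_le (K del c m : R) A : measurable A ->
  (0 < K)%R -> (0 < del)%R -> mu setT <= m%:E ->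
  mu [set x | del%:E <= `|g x - f x|] <= c%:E ->
  `|\int[mu]_(x in A) (trunc K (g x))%:E -
    \int[mu]_(x in A) (trunc K (f x))%:E| <= (2 * K * c + del * m)%:E.
Proof.
move=> mA K0 del0 mum Bc; set B := [set x | _] in Bc.
have mBd : measurable B by exact: mB.
have tgi : mu.-integrable setT (EFin \o (trunc K \o g)).
  by apply: trunc_int => //; exact: ltW.
have tfi : mu.-integrable setT (EFin \o (trunc K \o f)).
  by apply: trunc_int => //; exact: ltW.
have tgA : mu.-integrable A (EFin \o (trunc K \o g)) by exact: integrableS tgi.
have tfA : mu.-integrable A (EFin \o (trunc K \o f)) by exact: integrableS tfi.
have mD := measurable_int mu (integrableB mA tgA tfA).
have mDT := measurable_int mu (integrableB measurableT tgi tfi).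
rewrite -(integralB mA tgA tfA) (le_trans (le_abse_integral _ mA mD))//.
apply: (@le_trans _ _ (\int[mu]_x `|(trunc K (g x))%:E - (trunc K (f x))%:E|)).
  by apply: ge0_subset_integral => //; exact: measurableT_comp.
apply: (@le_trans _ _ (\int[mu]_x ((2 * K)%:E * (\1_B x)%:E + cst del%:E x))).
  apply: ge0_le_integral => //.
  - exact: measurableT_comp.
  - apply: emeasurable_funD => //; apply: emeasurable_funM => //.
    exact/measurable_EFinP.
  move=> x _; rewrite indicE; have [xB|] := boolP (x \in B).
    rewrite mule1 -EFinB -EFinD abse_EFin lee_fin.
    have := trunc_le (g x) (ltW K0); have := trunc_le (f x) (ltW K0).
    by rewrite !ler_norml; lra.
  rewrite mule0 add0e notin_setE => xB.
  by rewrite (le_trans (dist_trunc_le _ _ (ltW K0)))// ltW// ltNge; exact/negP.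
rewrite ge0_integralD//; last 3 first.
- by move=> x _; rewrite lee_fin mulr_ge0// mulr_ge0// ltW.
- by apply: emeasurable_funM => //; exact/measurable_EFinP.
- by move=> x _ /=; rewrite lee_fin ltW.
rewrite ge0_integralZl_EFin//; last 2 first.
- exact/measurable_EFinP.
- by rewrite mulr_ge0// ltW.
rewrite integral_indic// setIT integral_cst// EFinD !EFinM; apply: leeD.
  by rewrite -EFinM lee_wpmul2l// lee_fin mulr_ge0// ltW.
by rewrite lee_wpmul2l// lee_fin ltW.
Qed.

(** The steps from g d(nu) to f d(mu): truncate g, change the measure, replace
the truncation of g by that of f, undo the truncation. They cost a, K * t,
2 * K * c + del * m and b. *)
Lemma dist_integral_le (K del a b c m : R) A : measurable A ->
  (0 < K)%R -> (0 < del)%R -> mu setT <= m%:E ->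
  tail nu g K <= a%:E -> tail mu f K <= b%:E ->
  mu [set x | del%:E <= `|g x - f x|] <= c%:E ->
  `|\int[nu]_(x in A) g x - \int[mu]_(x in A) f x| <=
    (a + K * t + (2 * K * c + del * m) + b)%:E.
Proof.
move=> mA K0 del0 mum ga fb Bc; have K0' := ltW K0.
have := integral_trunc_le mA gi K0' ga (trunc_int nuT mg K0').
have := integral_trunc_le mA fi K0' fb (trunc_int muT mf K0').
have := tv_integral_le nuT muT numu mA (measurable_trunc K mg) K0
  (fun x => trunc_le (g x) K0').
have := integral_trunc_dist_le mA K0 del0 mum Bc.
have [? ->] := integral_realE mA gi.
have [? ->] := integral_realE mA fi.
have [? /= ->] := integral_realE mA (trunc_int nuT mg K0').
have [? /= ->] := integral_realE mA (trunc_int muT mg K0').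
have [? /= ->] := integral_realE mA (trunc_int muT mf K0').
rewrite -!EFinB ?abse_EFin !lee_fin !ler_norml; lra.
Qed.

(** The hypothesis is applied on the subsets of A where g is nonnegative and
where it is negative: on each of them the integral of `|g| is, up to sign, that
of g. Each application loses e. *)
Lemma integral_abs_le (e : R) A :
  (forall B, measurable B ->
     `|\int[nu]_(x in B) g x - \int[mu]_(x in B) f x| <= e%:E) ->
  measurable A ->
  \int[nu]_(x in A) `|g x| <= \int[mu]_(x in A) `|f x| + (2 * e)%:E.
Proof.
move=> numue mA.
pose P := A `&` [set x | 0 <= g x]; pose N := A `&` [set x | g x < 0].
have mP : measurable P.
  by apply: emeasurable_fun_c_infty => //; exact: measurable_funTS.
have mN : measurable N.
  by apply: emeasurable_fun_infty_o => //; exact: measurable_funTS.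
have PN : [disjoint P & N].
  apply/disj_setPS => x [[_ /= gx0] [_ /=]].
  by rewrite ltNge gx0.
have APN : A = P `|` N.
  rewrite -setIUr; apply/esym/setIidPl => x _ /=.
  by case: (leP 0 (g x)) => ?; [left|right].
have absg := integrable_abse gi; have absf := integrable_abse fi.
rewrite APN !integral_setU//; last 2 first.
- exact: measurable_funTS (measurable_int _ absf).
- exact: measurable_funTS (measurable_int _ absg).
have -> : \int[nu]_(x in P) `|g x| = \int[nu]_(x in P) g x.
  by apply: eq_integral => x; rewrite inE => -[_ /= ?]; rewrite gee0_abs.
have -> : \int[nu]_(x in N) `|g x| = - \int[nu]_(x in N) g x.
  rewrite -integralN; last first.
    by apply: integrable_add_def => //; exact: integrableS gi.
  by apply: eq_integral => x; rewrite inE => -[_ /= ?]; rewrite lte0_abs.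
have := le_abse_integral mu mP (measurable_funTS mf).
have := le_abse_integral mu mN (measurable_funTS mf).
have := numue P mP; have := numue N mN.
have [? ->] := integral_realE mP gi; have [? ->] := integral_realE mN gi.
have [? ->] := integral_realE mP fi; have [? ->] := integral_realE mN fi.
have [? /= ->] := integral_realE mP absf.
have [? /= ->] := integral_realE mN absf.
rewrite -?EFinB ?abse_EFin -?EFinN -?EFinD !lee_fin !ler_norml; lra.
Qed.

(** [integral_abs_le] on A, the set where K <= `|g|, leaves the integral of `|f|
over A, which is at most b + L * mu A. Markov's inequality bounds nu A, and mu A
exceeds it by at most t. *)
Lemma tail_le (e K L M b : R) :
  (forall B, measurable B ->
     `|\int[nu]_(x in B) g x - \int[mu]_(x in B) f x| <= e%:E) ->
  (0 < K)%R -> (0 <= L)%R -> \int[mu]_x `|f x| <= M%:E -> tail mu f L <= b%:E ->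
  tail nu g K <= (b + L * ((M + 2 * e) / K + t) + 2 * e)%:E.
Proof.
move=> numue K0 L0 fM fb.
have mA := measurable_abs_ge K mg; set A := [set x | _] in mA.
have nuA : nu A <= ((M + 2 * e) / K)%:E.
  apply: markov_abs_ge => //.
  by rewrite (le_trans (integral_abs_le numue measurableT))// EFinD leeD2r.
have muA : mu A <= ((M + 2 * e) / K + t)%:E.
  by rewrite (le_trans (tv_measure_le nuT muT numu mA))// EFinD leeD2r.
apply: (le_trans (integral_abs_le numue mA)).
rewrite EFinD leeD2r//.
have mf' : measurable_fun setT (abse \o f) by exact: measurableT_comp.
apply: (@le_trans _ _ (\int[mu]_(x in A)
    (((abse \o f) \_ [set x | L%:E <= `|f x|]) x + cst L%:E x))).
  apply: ge0_le_integral => //.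
  - exact: measurable_funTS.
  - apply: emeasurable_funD => //; apply: measurable_funTS.
    apply/(measurable_restrictT _ (measurable_abs_ge _ mf)).
    exact: measurable_funTS.
  move=> x Ax; rewrite patchE /=; case: ifPn => [_|].
    by rewrite leeDl// lee_fin.
  by rewrite notin_setE /= add0e => ?; rewrite ltW// ltNge; exact/negP.
rewrite ge0_integralD//; last 2 first.
- by move=> x _; apply: erestrict_ge0 => y _ /=.
- apply: measurable_funTS.
  apply/(measurable_restrictT _ (measurable_abs_ge _ mf)).
  exact: measurable_funTS.
rewrite integral_cst// EFinD; apply: leeD; last by rewrite EFinM lee_wpmul2l.
apply: le_trans fb; rewrite /tail [leRHS]integral_mkcond.
apply: ge0_subset_integral => //.
  apply/(measurable_restrictT _ (measurable_abs_ge _ mf)).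
  exact: measurable_funTS.
by move=> x _; apply: erestrict_ge0 => y _ /=.
Qed.

(** Let h be f truncated at K, plus eps. On the set in the statement, h = f +
eps is bounded by K + eps and lies below g. Thus, over this set, the integral of
f d(mu) plus eps times the mu-measure is the integral of h d(mu), which exceeds
that of h d(nu), hence that of g d(nu), by at most (K + eps) * t; and the
integral of g d(nu) is at most that of f d(mu) plus e. *)
Lemma measure_excess_le (e eps K : R) : (0 < eps)%R -> (0 <= K)%R ->
  (forall B, measurable B ->
     `|\int[nu]_(x in B) g x - \int[mu]_(x in B) f x| <= e%:E) ->
  mu ([set x | `|f x| <= K%:E] `&` [set x | 0 <= g x - (f x + eps%:E)]) <=
    ((e + (K + eps) * t) / eps)%:E.
Proof.
move=> eps0 K0 numue; set A := _ `&` _.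
have mA : measurable A.
  apply: measurableI.
    rewrite -[X in measurable X]setTI; apply: emeasurable_fun_infty_c => //.
    exact: measurableT_comp.
  rewrite -[X in measurable X]setTI; apply: emeasurable_fun_c_infty => //.
  by apply: emeasurable_funB => //; exact: emeasurable_funD.
pose h x := (trunc K (f x) + eps)%R.
have mh : measurable_fun setT h.
  by apply: measurable_funD => //; exact: measurable_trunc.
have hK x : (`|h x| <= K + eps)%R.
  by have := trunc_le (f x) K0; rewrite /h !ler_norml; lra.
have hA x : x \in A -> (h x)%:E = f x + eps%:E.
  by rewrite inE => -[/= fK _]; rewrite EFinD trunc_id.
have hnui := bounded_integrable nuT mh hK.
have hmui := bounded_integrable muT mh hK.
have hg : \int[nu]_(x in A) (h x)%:E <= \int[nu]_(x in A) g x.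
  apply: le_integral => //; [exact: integrableS hnui|exact: integrableS gi|].
  move=> x xA; rewrite hA//; move: xA; rewrite inE => -[/= fK].
  have ffin : f x \is a fin_num by rewrite fin_num_abs (le_lt_trans fK)// ltry.
  by rewrite sube_ge0 ?fin_numD ?ffin.
have hf : \int[mu]_(x in A) (h x)%:E = \int[mu]_(x in A) f x + eps%:E * mu A.
  rewrite -integral_cst// -integralD//.
  - by apply: eq_integral => x xA; rewrite hA.
  - exact: integrableS fi.
  - have := @bounded_integrable _ _ _ mu (cst eps) eps muT (measurable_cst _).
    move=> /(_ (fun=> _)) h'; apply: (integrableS measurableT mA) => //.
    by apply: h' => x; rewrite gtr0_norm.
have := tv_integral_le nuT muT numu mA mh (ltr_wpDl K0 eps0) hK.
have := numue A mA; move: hg hf.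
have [? ->] := integral_realE mA gi; have [? ->] := integral_realE mA fi.
have [? /= ->] := integral_realE mA hnui.
have [? /= ->] := integral_realE mA hmui.
have : mu A \is a fin_num.
  by rewrite ge0_fin_numE// (le_lt_trans _ muT)// le_measure// inE.
case: (mu A) => [r| |]//= _.
rewrite -?EFinB ?abse_EFin -?EFinM -?EFinD => + [->].
rewrite !lee_fin !ler_norml ler_pdivlMr//; lra.
Qed.

End comparison.

(** * Convergence in measure *)

Section in_measure.
Context d (T : measurableType d) (R : realType).

(** Where `|f x| < K and `|g x - f x| >= eps, either g exceeds f by eps or - g
exceeds - f by eps; [measure_excess_le] bounds each case. With 1 <= K the tail
bounds the measure of the remaining set. *)
Lemma measure_dist_le (nu mu : {measure set T -> \bar R}) (g f : T -> \bar R)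
    (t e eps K b : R) :
  nu setT < +oo -> mu setT < +oo -> tv_dist nu mu <= t%:E ->
  nu.-integrable setT g -> mu.-integrable setT f ->
  (forall B, measurable B ->
     `|\int[nu]_(x in B) g x - \int[mu]_(x in B) f x| <= e%:E) ->
  (0 < eps)%R -> (1 <= K)%R -> tail mu f K <= b%:E ->
  mu [set x | eps%:E <= `|g x - f x|] <=
    (b + 2 * ((e + (K + eps) * t) / eps))%:E.
Proof.
move=> nuT muT numu gi fi numue eps0 K1 fb.
have mg := measurable_int nu gi; have mf := measurable_int mu fi.
have K0 : (0 <= K)%R by rewrite (le_trans _ K1).
pose excess (u v : T -> \bar R) :=
  [set x | `|v x| <= K%:E] `&` [set x | 0 <= u x - (v x + eps%:E)].
have mexcess u v : measurable_fun setT u -> measurable_fun setT v ->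
    measurable (excess u v).
  move=> mu_ mv; apply: measurableI; rewrite -[X in measurable X]setTI.
    by apply: emeasurable_fun_infty_c => //; exact: measurableT_comp.
  apply: emeasurable_fun_c_infty => //.
  by apply: emeasurable_funB => //; exact: emeasurable_funD.
pose gN := -%E \o g; pose fN := -%E \o f.
have giN : nu.-integrable setT gN by exact: integrableN.
have fiN : mu.-integrable setT fN by exact: integrableN.
have numueN B : measurable B ->
    `|\int[nu]_(x in B) gN x - \int[mu]_(x in B) fN x| <= e%:E.
  move=> mB; have := numue B mB.
  rewrite /gN /fN !integralN; last 2 first.
  - by apply: (integrable_add_def mB); exact: integrableS fi.
  - by apply: (integrable_add_def mB); exact: integrableS gi.
  have [? ->] := integral_realE mB gi; have [? ->] := integral_realE mB fi.
  by rewrite -!EFinN -!EFinD !abse_EFin !lee_fin !ler_norml; lra.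
have pos := measure_excess_le nuT muT numu gi fi eps0 K0 numue.
have neg := measure_excess_le nuT muT numu giN fiN eps0 K0 numueN.
have mtail := measurable_abs_ge K mf.
have mpos : measurable (excess g f) by exact: mexcess.
have mneg : measurable (excess gN fN).
  by apply: mexcess; apply: measurableT_comp.
apply: (@le_trans _ _
    (mu ([set x | K%:E <= `|f x|] `|` (excess g f `|` excess gN fN)))).
  apply: le_measure; rewrite ?inE//.
  - by apply: measurable_abs_ge; exact: emeasurable_funB.
  - by apply: measurableU => //; exact: measurableU.
  move=> x /= xB; have [fK|fK] := leP K%:E `|f x|; first by left.
  right; rewrite /excess /gN /fN /= abseN (ltW fK).
  move: xB fK; case: (f x) => [r| |]// + _.
  case: (g x) => [s| |]; last 2 first.
  - by move=> _; left; split => //=; rewrite leey.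
  - by move=> _; right; split => //=; rewrite leey.
  rewrite -!EFinN -!EFinD abse_EFin !lee_fin.
  by case: (ger0P (s - r)) => ? ?; [left|right]; split => //; lra.
apply: (le_trans (measureU2 _ mtail _)); first exact: measurableU.
rewrite EFinD; apply: leeD.
  by rewrite (le_trans (measure_abs_ge_tail mu mf K1)).
apply: (le_trans (measureU2 _ mpos mneg)).
by rewrite mulr_natl mulr2n EFinD leeD.
Qed.

(** Choose k j so large that the set where f_ (k j) is 2^-(j+1)-far from f has
measure at most 2^-(j+1). By the Borel-Cantelli lemma almost every point lies in
finitely many of these sets, and it is a point of convergence if f is finite
there. *)
Lemma cvg_in_measure_subseq (mu : {measure set T -> \bar R})
    (f_ : nat -> T -> \bar R) (f : T -> \bar R) :
  (forall n, measurable_fun setT (f_ n)) -> measurable_fun setT f ->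
  {ae mu, forall x, f x \is a fin_num} ->
  cvg_in_measure mu f_ f ->
  exists2 k : nat -> nat,
    {homo k : m n / (m < n)%N} & cvg_ae mu (fun j => f_ (k j)) f.
Proof.
move=> mf_ mf ffin f_f.
pose w j : R := (1 / (2 ^ j.+1)%:R)%R.
have w0 j : (0 < w j)%R by rewrite divr_gt0// ltr0n expn_gt0.
pose F j n := [set x | (w j)%:E <= `|f_ n x - f x|].
have /choice[N FN] : forall j, exists N,
    forall n, (N <= n)%N -> mu (F j n) <= (w j)%:E.
  move=> j; have /ge0_cvge0P/(_ _ (w0 j))[//|N _ FN] := f_f _ (w0 j).
  by exists N => n Nn; exact: FN.
(* The partial sums dominate N and make k strictly increasing. *)
pose k j := (\sum_(i < j.+1) (N i).+1)%N.
have Nk j : (N j <= k j)%N by rewrite /k big_ord_recr/=; lia.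
exists k.
  apply: homo_ltn; first exact: ltn_trans.
  by move=> j; rewrite /k [ltnRHS]big_ord_recr/=; lia.
have mF j : measurable (F j (k j)).
  by apply: measurable_abs_ge; exact: emeasurable_funB.
have limsupF0 : mu (lim_sup_set (fun j => F j (k j))) = 0.
  apply: lim_sup_set_cvg0 => //.
  apply: (@le_lt_trans _ _ 1%:E); last exact: ltry.
  apply: le_trans (epsilon_trick0 xpredT ler01).
  by apply: lee_nneseries => // j _; exact: FN.
have notlimsup : {ae mu, forall x, ~ lim_sup_set (fun j => F j (k j)) x}.
  exists (lim_sup_set (fun j => F j (k j))); split => //.
    by apply: bigcap_measurable => // n _; exact: bigcup_measurable.
  by move=> x /= /contrapT.
rewrite /cvg_ae; apply: filterS2 ffin notlimsup => x fx.
have -> : f x = (fine (f x))%:E by rewrite fineK.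
move/existsNP => [n /not_implyP[_ xF]].
have close j : (n <= j)%N -> `|f_ (k j) x - f x| < (w j)%:E.
  by move=> nj; rewrite ltNge; apply/negP => ?; apply: xF; exists j.
apply/fine_cvgP; split.
  exists n => // j /= nj; move: (close j nj); case: (f x) fx => [r| |]// _.
  by case: (f_ (k j) x).
apply/cvgrPdist_lt => e e0; near=> j.
have nj : (n <= j)%N by near: j; exact: nbhs_infty_ge.
apply: (@lt_trans _ _ (w j)).
  move: (close j nj) => /=; case: (f x) fx => [r| |]// _.
  by case: (f_ (k j) x) => [s| |]//=; rewrite lte_fin distrC.
apply: (@le_lt_trans _ _ (1 / 2 ^+ j)%R).
  rewrite /w !div1r natrX lef_pV2 ?posrE ?exprn_gt0//.
  by rewrite ler_weXn2l ?ler1n.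
by near: j; exact: (near_infty_natSinv_expn_lt (PosNum e0)).
Unshelve. all: by end_near. Qed.

End in_measure.

(** * Uniform convergence of the integrals over measurable sets *)

Lemma tv_dist_ge0 d (T : measurableType d) (R : realType)
    (nu mu : set T -> \bar R) : 0 <= tv_dist nu mu.
Proof.
apply: le_ereal_sup_tmp.
exists `|\int[nu]_x (cst 0%R x)%:E - \int[mu]_x (cst 0%R x)%:E| => //.
by exists (cst 0%R) => //; split => // x /=; lra.
Qed.

Lemma near_forall_ltn (I : Type) (F : set_system I) (FF : Filter F)
    (P : nat -> I -> Prop) (N : nat) :
  (forall n, \forall i \near F, P n i) ->
  \forall i \near F, forall n, (n < N)%N -> P n i.
Proof.
move=> FP; elim: N => [|N IH]; first exact: nearW.
near=> i => n; rewrite ltnS leq_eqVlt => /predU1P[->|].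
  by near: i.
by apply: (near IH i).
Unshelve. all: by end_near. Qed.

Section uniform_setwise_convergence.
Context d (T : measurableType d) (R : realType).
Variables (mu_ : nat -> {finite_measure set T -> \bar R}).
Variable mu : {measure set T -> \bar R}.
Variables (f_ : nat -> T -> \bar R) (f : T -> \bar R).
Hypothesis mu_cvg : cvg_tv (fun n => mu_ n : set T -> \bar R) mu.
Hypothesis f_int : mu.-integrable setT f.
Hypothesis fn_int : forall n, (mu_ n).-integrable setT (f_ n).

Definition setwise_dist n : \bar R :=
  ereal_sup [set `|\int[mu_ n]_(x in A) f_ n x - \int[mu]_(x in A) f x| |
             A in measurable].

Definition unif_tail K : \bar R :=
  ereal_sup (range (fun n => tail (mu_ n) (f_ n) K)).

Lemma setwise_dist_ge0 n : 0 <= setwise_dist n.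
Proof.
apply: le_ereal_sup_tmp.
exists `|\int[mu_ n]_(x in set0) f_ n x - \int[mu]_(x in set0) f x| => //.
by exists set0.
Qed.

Lemma unif_tail_ge0 K : 0 <= unif_tail K.
Proof.
apply: le_ereal_sup_tmp.
by exists (tail (mu_ 0%N) (f_ 0%N) K); [exists 0%N|exact: tail_ge0].
Qed.

Lemma setwise_dist_leP n (e : R) : setwise_dist n <= e%:E ->
  forall B, measurable B ->
    `|\int[mu_ n]_(x in B) f_ n x - \int[mu]_(x in B) f x| <= e%:E.
Proof.
move=> ne B mB; apply: le_trans ne; apply: ereal_sup_ubound.
by exists B.
Qed.

Lemma near_tv_dist_le (e : R) : (0 < e)%R ->
  \forall n \near \oo, tv_dist (mu_ n) mu <= e%:E.
Proof.
by apply: (ge0_cvge0P _ _).1 mu_cvg e => n; exact: tv_dist_ge0.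
Qed.

Let mu_nT n : mu_ n setT < +oo.
Proof. by rewrite -ge0_fin_numE// fin_num_measure. Qed.

Lemma limit_finite : mu setT < +oo.
Proof.
have [N _ /(_ N (leqnn N)) tvN] := near_tv_dist_le ltr01.
exact: tv_finite (mu_nT N) tvN.
Qed.

Lemma near_tail_le (nu : {measure set T -> \bar R}) (g : T -> \bar R) (e : R) :
  nu.-integrable setT g -> (0 < e)%R ->
  \forall K \near +oo%R, tail nu g K <= e%:E.
Proof.
by move=> gi; apply: (ge0_cvge0P _ _).1 (tail_cvg0 gi) e => K; exact: tail_ge0.
Qed.

(** K is fixed first, to make both tails at most e / 5; then del, c and t are
chosen so that the three other terms of [dist_integral_le] are at most e / 5. *)
Lemma setwise_cvg : cvg_in_measure mu f_ f ->
  unif_tail K @[K --> +oo%R] --> 0 -> setwise_dist n @[n --> \oo] --> 0.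
Proof.
move=> f_f /(ge0_cvge0P _ unif_tail_ge0) ui.
apply/(ge0_cvge0P _ setwise_dist_ge0) => e e0.
have e5 : (0 < e / 5)%R by rewrite divr_gt0.
near (pinfty_nbhs R) => K.
have K0 : (0 < K)%R by near: K; exact: nbhs_pinfty_gt.
have uiK : unif_tail K <= (e / 5)%:E by near: K; exact: ui.
have fK : tail mu f K <= (e / 5)%:E by near: K; exact: near_tail_le.
pose m := fine (mu setT).
have mE : mu setT = m%:E by rewrite fineK// ge0_fin_numE// limit_finite.
have m0 : (0 <= m)%R by rewrite fine_ge0.
pose del := ((e / 5) / (m + 1))%R.
have del0 : (0 < del)%R by rewrite divr_gt0// ltr_wpDl.
pose c := (e / 5 / (2 * K))%R.
have c0 : (0 < c)%R by rewrite divr_gt0// mulr_gt0.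
pose t := (e / 5 / K)%R.
have t0 : (0 < t)%R by rewrite divr_gt0.
near=> n; apply: ge_ereal_sup => _ [A mA <-].
have tvn : tv_dist (mu_ n) mu <= t%:E by near: n; exact: near_tv_dist_le.
have Bn : mu [set x | del%:E <= `|f_ n x - f x|] <= c%:E.
  near: n; apply: (ge0_cvge0P _ _).1 (f_f _ del0) c c0 => n.
  exact: measure_ge0.
have fnK : tail (mu_ n) (f_ n) K <= (e / 5)%:E.
  by apply: le_trans uiK; apply: ereal_sup_ubound; exists n.
have mE' : mu setT <= m%:E by rewrite mE.
apply: (le_trans (dist_integral_le (mu_nT n) limit_finite tvn (fn_int n) f_int
  mA K0 del0 mE' fnK fK Bn)).
rewrite lee_fin.
have -> : (K * t = e / 5)%R by rewrite /t; field; lra.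
have -> : (2 * K * c = e / 5)%R by rewrite /c; field; lra.
have : (del * m <= e / 5)%R.
  by rewrite /del mulrAC ler_pdivrMr ?ltr_wpDl// ler_wpM2l ?ltW//; lra.
lra.
Unshelve. all: by end_near. Qed.

Hypothesis setwise0 : setwise_dist n @[n --> \oo] --> 0.

Lemma near_setwise_dist_le (e : R) : (0 < e)%R ->
  \forall n \near \oo, setwise_dist n <= e%:E.
Proof. exact: (ge0_cvge0P _ setwise_dist_ge0).1 setwise0 e. Qed.

(** The constants s and t make the bound of [measure_dist_le] equal to
e / 3 + 2 * (s + s) / eps = e / 3 + 2 * e / 3. *)
Lemma setwise_cvg_in_measure : cvg_in_measure mu f_ f.
Proof.
move=> eps eps0; apply/ge0_cvge0P => [n|e e0]; first exact: measure_ge0.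
near (pinfty_nbhs R) => K.
have K1 : (1 <= K)%R by near: K; exact: nbhs_pinfty_ge.
have fK : tail mu f K <= (e / 3)%:E.
  by near: K; apply: near_tail_le => //; rewrite divr_gt0.
pose s := (e * eps / 6)%R.
have s0 : (0 < s)%R by rewrite divr_gt0// mulr_gt0.
pose t := (s / (K + eps))%R.
have t0 : (0 < t)%R by rewrite divr_gt0//; lra.
near=> n.
have tvn : tv_dist (mu_ n) mu <= t%:E by near: n; exact: near_tv_dist_le.
have dn : setwise_dist n <= s%:E by near: n; exact: near_setwise_dist_le.
apply: (le_trans (measure_dist_le (mu_nT n) limit_finite tvn (fn_int n) f_int
  (setwise_dist_leP dn) eps0 K1 fK)).
rewrite lee_fin.
have -> : ((K + eps) * t = s)%R by rewrite /t; field; lra.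
have -> : (2 * ((s + s) / eps) = 2 * e / 3)%R by rewrite /s; field; lra.
lra.
Unshelve. all: by end_near. Qed.

(** Once L, then s and t, then K are chosen, the four terms of [tail_le] are at
most e / 4 for all n >= N; the integrals with n < N are made small by taking K
larger still. *)
Lemma setwise_cvg_unif_tail : unif_tail K @[K --> +oo%R] --> 0.
Proof.
apply/(ge0_cvge0P _ unif_tail_ge0) => e e0.
near (pinfty_nbhs R) => L.
have L0 : (0 <= L)%R by near: L; exact: nbhs_pinfty_ge.
have fL : tail mu f L <= (e / 4)%:E.
  by near: L; apply: near_tail_le => //; rewrite divr_gt0.
pose M := fine (\int[mu]_x `|f x|).
have fM : \int[mu]_x `|f x| <= M%:E.
  rewrite /M fineK//; apply: integrable_fin_num => //.
  exact: integrable_abse.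
pose s := (e / 8)%R.
have s0 : (0 < s)%R by rewrite divr_gt0.
pose t := (e / 4 / (L + 1))%R.
have t0 : (0 < t)%R by rewrite !divr_gt0//; lra.
have : \forall n \near \oo,
    tv_dist (mu_ n) mu <= t%:E /\ setwise_dist n <= s%:E.
  near=> n; split; near: n; first exact: near_tv_dist_le.
  exact: near_setwise_dist_le.
move=> [N _ HN].
near=> K.
have head n : (n < N)%N -> tail (mu_ n) (f_ n) K <= e%:E.
  move: n; near: K; apply: near_forall_ltn => n.
  exact: near_tail_le (fn_int n) e0.
have K0 : (0 < K)%R by near: K; exact: nbhs_pinfty_gt.
have KM : (4 * L * (M + 2 * s) / e <= K)%R.
  by near: K; apply: nbhs_pinfty_ge; exact: num_real.
apply: ge_ereal_sup => _ [n _ <-].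
have [nN|Nn] := ltnP n N; first exact: head.
have [tvn dn] := HN n Nn.
apply: (le_trans (tail_le (mu_nT n) limit_finite tvn (fn_int n) f_int
  (setwise_dist_leP dn) K0 L0 fM fL)).
rewrite lee_fin mulrDr.
have : (L * ((M + 2 * s) / K) <= e / 4)%R.
  rewrite mulrA ler_pdivrMr//; move: KM; rewrite ler_pdivrMr//; lra.
have : (L * t <= e / 4)%R.
  by rewrite /t mulrA ler_pdivrMr; [nra|lra].
rewrite /s; lra.
Unshelve. all: by end_near. Qed.

End uniform_setwise_convergence.

Theorem corollary1p8 (R : realType) (d : measure_display)
    (T : measurableType d)
    (mu_ : nat -> {finite_measure set T -> \bar R})
    (mu : {measure set T -> \bar R})
    (f_ : nat -> T -> \bar R) (f : T -> \bar R)
    (mu_cvg : cvg_tv (fun n => mu_ n : set T -> \bar R) mu)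
    (f_int : mu.-integrable setT f)
    (fn_int : forall n, (mu_ n).-integrable setT (f_ n)) :
  (ereal_sup [set `|\int[mu_ n]_(x in A) f_ n x - \int[mu]_(x in A) f x| |
                  A in measurable] @[n --> \oo] --> 0
   <->
   cvg_in_measure mu f_ f /\
   ereal_sup (range (fun n =>
     \int[mu_ n]_(x in [set x | K%:E <= `|f_ n x|]) `|f_ n x|))
     @[K --> +oo%R] --> 0)
  /\
  (cvg_in_measure mu f_ f ->
   exists2 k : nat -> nat,
     {homo k : m n / (m < n)%N} & cvg_ae mu (fun j => f_ (k j)) f).
Proof.
split; [split => [setwise0|[f_f ui]]|].
- split; first exact: setwise_cvg_in_measure setwise0.
  exact: setwise_cvg_unif_tail setwise0.
- exact: setwise_cvg.
apply: cvg_in_measure_subseq.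
- by move=> n; exact: measurable_int (fn_int n).
- exact: measurable_int f_int.
- by have := integrable_ae measurableT f_int; apply: filterS => x; apply.
Qed.
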